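(* Let $\mathcal{Q}(C)$ be a covering polyhedron and let $\mathcal{F}=\{I_n\}_{n=0}^\infty$ be its associated filtration. The following hold. (a) $\overline{I_1^n}=I_n$ for all $n\geq 1$ if and only if $\mathcal{Q}(C)$ is integral. (b) $I_1^n=I_n$ for all $n\geq 1$ if and only if $\mathcal{Q}(C)$ is integral and $I_1$ is normal.
   Context: $S=K[t_1,\ldots,t_s]$ is a polynomial ring over a field $K$, $\mathbb{N}=\{0,1,\ldots\}$, $t^a=t_1^{a_1}\cdots t_s^{a_s}$ for $a\in\mathbb{N}^s$; vector inequalities are componentwise and $1$ also denotes $(1,\ldots,1)$. A covering polyhedron is a polyhedron $\mathcal{Q}(C)=\{x\in\mathbb{R}^s\mid x\geq 0;\ xC\geq 1\}$ ($x$ a row vector), where $C$ is an $s\times m$ matrix with non-negative rational entries and non-zero columns; it is integral if all its vertices have integer entries. Its associated filtration is $I_0=S$ and, for $n\geq 1$, $I_n$ the ideal generated by all monomials $t^a$, $a\in\mathbb{N}^s$, with $a/n\in\mathcal{Q}(C)$. $\overline{L}$ is the integral closure of an ideal $L$; $L$ is normal if $L^n=\overline{L^n}$ for all $n\geq 1$. *)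

(* Defs.v *)
From HB Require Import structures.
From mathcomp Require Import all_boot all_order all_algebra.
From mathcomp Require Import classical_sets reals.
From mathcomp Require Import mpoly.
Set Implicit Arguments.
Unset Strict Implicit.
Unset Printing Implicit Defensive.
Import Order.TTheory GRing.Theory Num.Theory.
Local Open Scope ring_scope.
Local Open Scope classical_set_scope.

Section Ideals.
Variable A : comNzRingType.
Implicit Types (G I : set A) (f : A).

Definition ideal_gen G : set A :=
  [set f | exists (k : nat) (r g : 'I_k -> A),
     (forall i, G (g i)) /\ f = \sum_(i < k) r i * g i].

Definition ideal_pow I (n : nat) : set A :=
  ideal_gen [set f | exists g : 'I_n -> A,
     (forall i, I (g i)) /\ f = \prod_(i < n) g i].

Definition integral_closure I : set A :=
  [set f | exists (n : nat) (a : nat -> A),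
     [/\ (0 < n)%N,
         (forall i, (1 <= i <= n)%N -> ideal_pow I i (a i)) &
         f ^+ n + \sum_(1 <= i < n.+1) a i * f ^+ (n - i) = 0]].

Definition normal_ideal I : Prop :=
  forall n, (1 <= n)%N -> ideal_pow I n = integral_closure (ideal_pow I n).
End Ideals.

Section Polyhedra.
Variables (R : realType) (s : nat).
Implicit Types (P F : set 'rV[R]_s) (x y c : 'rV[R]_s).

Definition dotp x y : R := \sum_(i < s) x 0 i * y 0 i.

(* c = 0 is allowed, so P is a face of itself (and so is the empty set). *)
Definition is_face P F : Prop :=
  exists (c : 'rV[R]_s) (d : R),
    (forall y, P y -> d <= dotp c y) /\ F = P `&` [set y | dotp c y = d].

(* Vertices are the zero-dimensional faces. *)
Definition is_vertex P x : Prop := is_face P [set x].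

Definition integral_polyhedron P : Prop :=
  forall x, is_vertex P x -> forall i, x 0 i \is a Num.int.
End Polyhedra.

Section Covering.
Variables (R : realType) (s m : nat).
Implicit Type C : 'M[rat]_(s, m).

Definition covering_matrix C : Prop :=
  (forall i j, 0 <= C i j) /\ (forall j, col j C != 0).

Definition covering_polyhedron C : set 'rV[R]_s :=
  [set x : 'rV[R]_s | (forall i, 0 <= x 0 i) /\
           (forall j, 1 <= (x *m map_mx ratr C) 0 j)].
End Covering.
Arguments covering_polyhedron R {s m} C.

(* The ideals do not depend on the choice of R: membership of the rational
   point a / n is decided by rational inequalities. *)
Definition filtration (K : fieldType) (R : realType) (s m : nat)
    (C : 'M[rat]_(s, m)) (n : nat) : set {mpoly K[s]} :=
  if n is 0 then [set: {mpoly K[s]}] else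
  ideal_gen [set f | exists2 a : 'X_{1..s},
    covering_polyhedron R C (\row_i ((a i)%:R / n%:R)) & f = 'X_[a]].
Arguments filtration K R {s m} C n.

(* Main.v *)
Require Import Defs.
From HB Require Import structures.
From mathcomp Require Import all_boot all_order all_algebra perm.
From mathcomp Require Import classical_sets reals.
From mathcomp Require Import mpoly.
From mathcomp Require Import zify ring lra.
Set Implicit Arguments.
Unset Strict Implicit.
Unset Printing Implicit Defensive.
Import Order.TTheory GRing.Theory Num.Theory.
Local Open Scope ring_scope.
Local Open Scope classical_set_scope.


(** Everything is read off from the exponents of monomials.  The ideal [I_n]
    consists of the polynomials all of whose exponents [a] satisfy the
    inequalities [n <= a . C_j], one per column of [C].

    These inequalities say that monomial valuations are at least [n], and an
    element integral over an ideal of valuation at least [n] has valuation at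
    least [n] ([integral_closure_weight]); so each [I_n] is integrally closed.
    Since [I_1 ^ n] is contained in [I_n], its integral closure is too.

    When the polyhedron is integral, every rational point of it dominates a
    convex combination of vertices with rational weights, that is, an average
    of lattice points of the polyhedron ([integral_above_average]).  Clearing
    denominators, some power [N] of a monomial of [I_n] lies in
    [(I_1 ^ n) ^ N], so the monomial is integral over [I_1 ^ n].  The integral
    closure of an ideal is an ideal ([integral_closure_ideal], by the
    determinant trick), hence contains all of [I_n].

    Conversely, let [x] be a vertex, exposed by a linear form [c].  It is
    rational ([vertex_rational]), so [n x] is an exponent in [I_n] for some
    [n].  If this monomial is integral over [I_1 ^ n], comparing coefficients in
    an equation of integral dependence shows that [x] dominates an average of
    lattice points of the polyhedron ([closure_monomial]); as [c] is
    nonnegative and is minimal on the polyhedron only at [x], one of these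
    lattice points is [x] ([closure_integral]).  This is (a).

    For (b), if [I_1 ^ n = I_n] for all [n], these ideals are integrally closed,
    which gives normality, and integrality by (a); the other direction
    substitutes normality into (a). *)

(** * Ideals, powers and integral closure *)

Section Ideals.
Variable A : comNzRingType.
Implicit Types (G H I J L : set A) (f g : A).

Definition is_ideal I : Prop :=
  [/\ I 0, forall f g, I f -> I g -> I (f + g) & forall r f, I f -> I (r * f)].

Lemma ideal_sum I (T : Type) (r : seq T) (P : pred T) (F : T -> A) :
  is_ideal I -> (forall t, P t -> I (F t)) -> I (\sum_(t <- r | P t) F t).
Proof. by move=> [I0 ID _] IF; apply: big_ind. Qed.

Lemma ideal_opp I f : is_ideal I -> I f -> I (- f).
Proof. by case=> _ _ IM If; rewrite -mulN1r; apply: IM. Qed.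

Lemma ideal_genP G : is_ideal (ideal_gen G).
Proof.
split.
- by exists 0%N, (fun _ => 0), (fun _ => 0); split; [case|rewrite big_ord0].
- move=> _ _ [k [r [g [Gg ->]]]] [k' [r' [g' [Gg' ->]]]].
  exists (k + k')%N, (fun i => match split i with inl j => r j | inr j => r' j end),
    (fun i => match split i with inl j => g j | inr j => g' j end); split.
    by move=> i; case: (split i).
  rewrite big_split_ord /=; congr (_ + _); apply: eq_bigr => i _.
    by rewrite (unsplitK (inl i)).
  by rewrite (unsplitK (inr i)).
- move=> c _ [k [r [g [Gg ->]]]].
  exists k, (fun i => c * r i), g; split=> //.
  by rewrite mulr_sumr; apply: eq_bigr => i _; rewrite mulrA.
Qed.

Lemma mem_ideal_gen G g : G g -> ideal_gen G g.
Proof.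
by move=> Gg; exists 1%N, (fun _ => 1), (fun _ => g); rewrite big_ord1 mul1r.
Qed.

Lemma ideal_gen_min G J : is_ideal J -> G `<=` J -> ideal_gen G `<=` J.
Proof.
move=> idJ GJ _ [k [r [g [Gg ->]]]]; apply: ideal_sum => // i _.
by case: idJ => _ _; apply; apply: GJ.
Qed.

(** Passing to the ideal quotients [J : g] and then [J : f] reduces products of
    arbitrary elements to products of generators. *)
Lemma ideal_gen_mul G H J f g : is_ideal J ->
  (forall x y, G x -> H y -> J (x * y)) ->
  ideal_gen G f -> ideal_gen H g -> J (f * g).
Proof.
move=> [J0 JD JM] GHJ Gf Hg.
suff : ideal_gen G `<=` [set x | J (x * g)] by apply.
apply: ideal_gen_min.
  split=> [|x y Jx Jy|r x Jx] /=; rewrite ?mul0r ?mulrDl -?mulrA; by auto.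
move=> x Gx /=.
suff : ideal_gen H `<=` [set y | J (x * y)] by apply.
apply: ideal_gen_min => [|y]; last exact: GHJ.
split=> [|y z Jy Jz|r y Jy] /=; rewrite ?mulr0 ?mulrDr 1?mulrCA; by auto.
Qed.

Lemma ideal_powP I n : is_ideal (ideal_pow I n).
Proof. exact: ideal_genP. Qed.

Lemma ideal_pow_mem0 I n : ideal_pow I n 0.
Proof. by case: (ideal_powP I n). Qed.

Lemma ideal_pow0 I f : ideal_pow I 0 f.
Proof.
have [_ _ IM] := ideal_powP I 0.
rewrite -[f]mulr1; apply: IM; apply: mem_ideal_gen.
by exists (fun _ => 0); split; [case|rewrite big_ord0].
Qed.

Lemma ideal_powD I m n f g :
  ideal_pow I m f -> ideal_pow I n g -> ideal_pow I (m + n) (f * g).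
Proof.
apply: ideal_gen_mul => [|_ _ [x [Ix ->]] [y [Iy ->]]]; first exact: ideal_powP.
apply: mem_ideal_gen.
exists (fun i => match split i with inl j => x j | inr j => y j end); split.
  by move=> i; case: (split i).
rewrite big_split_ord /=; congr (_ * _); apply: eq_bigr => i _.
  by rewrite (unsplitK (inl i)).
by rewrite (unsplitK (inr i)).
Qed.

Lemma ideal_pow_anti I m n : (m <= n)%N -> ideal_pow I n `<=` ideal_pow I m.
Proof.
move=> le_mn; apply: ideal_gen_min; first exact: ideal_powP.
rewrite -(subnKC le_mn) => _ [x [Ix ->]].
rewrite big_split_ord /= mulrC; case: (ideal_powP I m) => _ _; apply.
by apply: mem_ideal_gen; exists (fun i => x (lshift _ i)).
Qed.

Lemma ideal_pow_prod I (T : eqType) (l : seq T) (F : T -> A) :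
  (forall t, t \in l -> I (F t)) -> ideal_pow I (size l) (\prod_(t <- l) F t).
Proof.
elim: l => [|t l IHl] IF; first exact: ideal_pow0.
rewrite big_cons; apply: (@ideal_powD I 1); last first.
  by apply: IHl => u lu; apply: IF; rewrite in_cons lu orbT.
apply: mem_ideal_gen; exists (fun _ => F t); rewrite big_ord1; split=> // _.
exact/IF/mem_head.
Qed.

Lemma ideal_powX I n f : I f -> ideal_pow I n (f ^+ n).
Proof.
move=> If; apply: mem_ideal_gen; exists (fun _ => f).
by rewrite prodr_const card_ord.
Qed.

(** The generators of [I ^ n] are products of [n] elements of [I], which can be
    absorbed one factor at a time. *)
Lemma ideal_pow_sub I (J : nat -> set A) :
    (forall n, is_ideal (J n)) -> J 0%N 1 ->
    (forall m f g, I f -> J m g -> J m.+1 (f * g)) ->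
  forall n, ideal_pow I n `<=` J n.
Proof.
move=> idJ J01 IJ n; apply: ideal_gen_min => // _ [x [Ix ->]].
elim: n x Ix => [|n IHn] x Ix; first by rewrite big_ord0.
by rewrite big_ord_recl; apply: IJ => //; apply: IHn => i; apply: Ix.
Qed.

Lemma mem_integral_closure_pow L k f :
  (0 < k)%N -> ideal_pow L k (f ^+ k) -> integral_closure L f.
Proof.
move=> k0 Lfk; exists k, (fun i => if i == k then - f ^+ k else 0); split=> //.
  move=> i _; case: eqP => [->|_]; last exact: ideal_pow_mem0.
  exact: ideal_opp (ideal_powP L k) Lfk.
rewrite big_nat_recr //= eqxx subnn expr0 mulr1 big_nat big1 ?add0r ?subrr //.
by move=> i /andP[_ lt_ik]; rewrite (ltn_eqF lt_ik) mul0r.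
Qed.

Lemma sub_integral_closure L : L `<=` integral_closure L.
Proof.
by move=> f Lf; apply: (@mem_integral_closure_pow L 1) => //; apply: ideal_powX.
Qed.

(** The determinant trick, graded by [w].  The characteristic polynomial of [B]
    vanishes at [f] by Cramer's rule, as [v t0] is [1].  The weights cancel along
    each permutation in the expansion of the determinant, so its coefficients
    lie in the powers of [L] that an equation of integral dependence demands.
    The grading replaces the finite generation of [L] in the usual argument. *)
Lemma det_trick L (T : finType) (w : T -> nat) (B : T -> T -> A)
    (v : T -> A) (f : A) (t0 : T) :
    v t0 = 1 ->
    (forall i, f * v i = \sum_j B i j * v j) ->
    (forall i j, ideal_pow L ((w i).+1 - w j) (B i j)) ->
  integral_closure L f.
Proof.
move=> vt0 fv LB; pose D := #|T|.
have D0 : (0 < D)%N by apply/card_gt0P; exists t0.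
pose M : 'M[A]_D := \matrix_(i, j) B (enum_val i) (enum_val j).
pose chi := char_poly M.
have chif : chi.[f] = 0.
  pose V : 'cV[A]_D := \col_i v (enum_val i).
  pose N : 'M[A]_D := f%:M - M.
  have NV : N *m V = 0.
    rewrite mulmxBl mul_scalar_mx; apply/eqP; rewrite subr_eq0; apply/eqP.
    apply/colP=> i; rewrite !mxE fv (reindex (@enum_val T T)) /=; last first.
      by exists enum_rank => x _; rewrite ?enum_valK ?enum_rankK.
    by apply: eq_big => j; rewrite ?mxE //; case: (enum_val j).
  have -> : chi.[f] = \det N.
    rewrite -[chi.[f]]/(horner_eval f chi) -det_map_mx; congr (\det _).
    apply/matrixP=> i j; rewrite !mxE /= /horner_eval hornerD hornerN hornerC.
    by rewrite hornerMn hornerX.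
  have := congr1 (mulmx (\adj N)) NV.
  rewrite mulmxA mul_adj_mx mulmx0 mul_scalar_mx => /colP/(_ (enum_rank t0)).
  by rewrite !mxE enum_rankK vt0 mulr1.
(* [Gr a b] is the filtered piece of degree [a - b], as a difference of
   naturals so that no signed exponents appear. *)
pose Gr a b : set {poly A} :=
  [set p | forall j, ideal_pow L (a - (b + j)) p`_j].
have GrM a b a' b' p q : Gr a b p -> Gr a' b' q -> Gr (a + a')%N (b + b')%N (p * q).
  move=> Gp Gq j; rewrite coefM; apply: ideal_sum; first exact: ideal_powP.
  move=> [k /= kj] _.
  have := ideal_powD (Gp k) (Gq (j - k)%N); apply: ideal_pow_anti; lia.
pose u (i : 'I_D) := w (enum_val i).
have Gr_entry i j :
    Gr (u i).+1 (u j) (char_poly_mx M i j).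
  move=> k; rewrite !mxE coefB coefMn coefX coefC.
  have [_ powD _] := ideal_powP L ((u i).+1 - (u j + k)).
  apply: powD.
    have [->|_] := eqVneq i j; last by rewrite mulr0n; exact: ideal_pow_mem0.
    have [->|_] := eqVneq k 1%N; last first.
      by rewrite mul0rn; exact: ideal_pow_mem0.
    by rewrite addn1 subnn; apply: ideal_pow0.
  apply: ideal_opp; first exact: ideal_powP.
  have [->|_] := eqVneq k 0%N; last exact: ideal_pow_mem0.
  by rewrite addn0; apply: LB.
have Gr_prod (s : 'S_D) :
    Gr (\sum_(i < D) (u i).+1)%N (\sum_(i < D) u (s i))%N
       (\prod_(i < D) char_poly_mx M i (s i)).
  apply: (big_ind3 (fun a b p => Gr a b p)) => [j|a b p a' b' q|i _].
  - by rewrite sub0n; apply: ideal_pow0.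
  - exact: GrM.
  - exact: Gr_entry.
have chi_coef j : ideal_pow L (D - j) chi`_j.
  rewrite /chi /char_poly /determinant coef_sum; apply: ideal_sum => [|s _].
    exact: ideal_powP.
  suff Lj : ideal_pow L (D - j) (\prod_(i < D) char_poly_mx M i (s i))`_j.
    rewrite mulr_sign; case: ifP => _ //.
    by rewrite coefN; apply: ideal_opp Lj; apply: ideal_powP.
  have := Gr_prod s j.
  have -> : (\sum_(i < D) u (s i) = \sum_(i < D) u i)%N.
    by rewrite [RHS](reindex_inj (@perm_inj _ s)).
  rewrite (eq_bigr (fun i => (1 + u i)%N)) // big_split /=.
  by rewrite sum_nat_const card_ord muln1; apply: ideal_pow_anti; lia.
exists D, (fun i => chi`_(D - i)); split=> // [i /andP[_ iD]|].
  by rewrite -{1}(subKn iD); apply: chi_coef.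
rewrite -[RHS]chif horner_coef size_char_poly big_ord_recr /= addrC.
congr (_ + _); last first.
  rewrite -(big_mkord xpredT (fun i => chi`_i * f ^+ i)).
  by rewrite [RHS]big_nat_rev add0n big_add1.
have := char_poly_monic M; rewrite monicE lead_coefE size_char_poly => /eqP /= ->.
by rewrite mul1r.
Qed.

(** The companion matrix of an equation of integral dependence, weighted by
    the exponent of [f]. *)
Lemma integral_closure_companion L f : integral_closure L f ->
  exists n (b : nat -> nat -> A), [/\ (0 < n)%N,
    forall i, (i < n)%N -> f * f ^+ i = \sum_(j < n) b i j * f ^+ j &
    forall i j, ideal_pow L (i.+1 - j) (b i j)].
Proof.
case=> n [a [n0 La fE]]; exists n.
exists (fun i j => if i.+1 == n then (if (j < n)%N then - a (n - j)%N else 0)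
                   else (j == i.+1)%:R).
split=> // [i lt_in|i j]; last first.
  have [/= ->|_] := eqVneq i.+1 n.
    case: ltnP => jn; last exact: ideal_pow_mem0.
    by apply: ideal_opp; [exact: ideal_powP|apply: La; lia].
  have [->|_] := eqVneq j i.+1; first by rewrite subnn; apply: ideal_pow0.
  exact: ideal_pow_mem0.
rewrite -exprS; have [->|ne_in] := eqVneq i.+1 n.
  move/eqP: fE; rewrite addr_eq0 => /eqP ->.
  rewrite big_add1 /= big_nat_rev /= add0n big_mkord -sumrN.
  apply: eq_bigr => -[j jn] _ /=; rewrite jn mulNr.
  by congr (- (a _ * f ^+ _)); lia.
have lt_i1n : (i.+1 < n)%N by rewrite ltn_neqAle ne_in.
rewrite (bigD1 (Ordinal lt_i1n)) //= eqxx mul1r big1 ?addr0 // => j.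
by rewrite -val_eqE /= => /negPf ->; rewrite mul0r.
Qed.

Lemma integral_closure_add L f g :
  integral_closure L f -> integral_closure L g -> integral_closure L (f + g).
Proof.
move=> /integral_closure_companion[n [b [n0 fE Lb]]].
move=> /integral_closure_companion[m [c [m0 gE Lc]]].
pose B (x y : 'I_n * 'I_m) :=
  (if x.2 == y.2 then b x.1 y.1 else 0) + (if x.1 == y.1 then c x.2 y.2 else 0).
pose v (x : 'I_n * 'I_m) := f ^+ x.1 * g ^+ x.2.
apply: (@det_trick L ('I_n * 'I_m)%type (fun x => x.1 + x.2)%N B v _
                   (Ordinal n0, Ordinal m0)).
- by rewrite /v /= mulr1.
- move=> [i j]; rewrite /v /= mulrDl mulrA fE // mulrCA gE //.
  under [RHS]eq_bigr do rewrite mulrDl.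
  rewrite big_split /=; congr (_ + _).
    rewrite -(pair_bigA _ (fun (k : 'I_n) (l : 'I_m) =>
      (if j == l then b i k else 0) * (f ^+ k * g ^+ l))) /=.
    rewrite mulr_suml; apply: eq_bigr => k _.
    rewrite (bigD1 j) //= eqxx mulrA big1 ?addr0 // => l.
    by rewrite eq_sym => /negPf ->; rewrite mul0r.
  rewrite -(pair_bigA _ (fun (k : 'I_n) (l : 'I_m) =>
    (if i == k then c j l else 0) * (f ^+ k * g ^+ l))) /=.
  rewrite (bigD1 i) //= eqxx [X in _ + X]big1 ?addr0 => [|k].
    by rewrite mulr_sumr; apply: eq_bigr => l _; rewrite mulrCA.
  by rewrite eq_sym => /negPf ne; apply: big1 => l _; rewrite ne mul0r.
- move=> [i j] [k l]; have [pow0 powD _] := ideal_powP L ((i + j).+1 - (k + l)).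
  apply: powD => /=.
    by case: eqP => // <-; have := Lb i k; congr (ideal_pow _ _ _); lia.
  by case: eqP => // <-; have := Lc j l; congr (ideal_pow _ _ _); lia.
Qed.

Lemma integral_closure_ideal L : is_ideal (integral_closure L).
Proof.
split=> [||r f]; [|exact: integral_closure_add|].
  apply: (@mem_integral_closure_pow L 1) => //; rewrite expr1.
  exact: ideal_pow_mem0.
case=> n [a [n0 La fE]]; exists n, (fun i => r ^+ i * a i); split=> //.
  by move=> i /La; case: (ideal_powP L i) => _ _; apply.
rewrite -[RHS](mulr0 (r ^+ n)) -[X in _ = _ * X]fE mulrDr exprMn; congr (_ + _).
rewrite mulr_sumr. apply: eq_big_nat => i /andP[_ le_in].
by rewrite exprMn -{3}(subnKC (m := i) (n := n)) // exprD; ring.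
Qed.

End Ideals.

(** * Ideals cut out by conditions on exponents *)

Section MonomialSupport.
Variables (K : fieldType) (s : nat).
Implicit Types (P Q T : 'X_{1..s} -> Prop) (f g : {mpoly K[s]}).

Definition mon_supp P : set {mpoly K[s]} :=
  [set f | forall a, a \in msupp f -> P a].

Lemma mon_supp0 P : mon_supp P 0.
Proof. by move=> a; rewrite msupp0. Qed.

Lemma mon_suppD P f g : mon_supp P f -> mon_supp P g -> mon_supp P (f + g).
Proof. by move=> Pf Pg a /msuppD_le; rewrite mem_cat => /orP[/Pf|/Pg]. Qed.

Lemma mon_suppN P f : mon_supp P f -> mon_supp P (- f).
Proof. by move=> Pf a; rewrite (perm_mem (msuppN f)) => /Pf. Qed.

Lemma mon_suppM P Q T f g : (forall a b, P a -> Q b -> T (a + b)%MM) ->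
  mon_supp P f -> mon_supp Q g -> mon_supp T (f * g).
Proof.
move=> PQT Pf Qg _ /msuppM_le /allpairsP[[a b] /= [fa gb ->]].
by apply: PQT; [apply: Pf|apply: Qg].
Qed.

Lemma mon_suppX P a : mon_supp P 'X_[a] <-> P a.
Proof.
split=> [|Pa b]; first by apply; rewrite msuppX mem_head.
by rewrite msuppX inE => /eqP ->.
Qed.

Lemma mon_supp_idealP P :
  (forall a b, P a -> P (b + a)%MM) -> is_ideal (mon_supp P).
Proof.
move=> upP; split=> [|f g|r f Pf]; [exact: mon_supp0|exact: mon_suppD|].
by apply: (mon_suppM (P := fun _ => True)) Pf => // a b _; apply: upP.
Qed.

Lemma ideal_gen_mon P : (forall a b, P a -> P (b + a)%MM) ->
  ideal_gen [set f | exists2 a, P a & f = 'X_[a]] = mon_supp P.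
Proof.
move=> upP; apply/seteqP; split.
  apply: ideal_gen_min; first exact: mon_supp_idealP.
  by move=> _ [a Pa ->]; apply/mon_suppX.
move=> f Pf; rewrite (mpolyE f) big_seq_cond.
apply: ideal_sum => [|a]; first exact: ideal_genP.
rewrite andbT => /Pf Pa; rewrite -mul_mpolyC.
by case: (ideal_genP [set f | exists2 a, P a & f = 'X_[K, a]]) => _ _; apply;
  apply: mem_ideal_gen; exists a.
Qed.

End MonomialSupport.

Lemma seq_argmin (F : realDomainType) (T : eqType) (g : T -> F) (l : seq T) x :
  x \in l -> exists2 a, a \in l & forall c, c \in l -> g a <= g c.
Proof.
elim: l x => // y l IHl x _; case: l IHl => [|z l] IHl.
  by exists y => [|c]; rewrite ?inE // => /eqP ->.
have [a la a_min] := IHl z (mem_head z l).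
case: (leP (g y) (g a)) => [ya|/ltW ay].
  exists y; first exact: mem_head.
  by move=> c; rewrite in_cons => /predU1P[-> //|/a_min]; apply: le_trans.
exists a; first by rewrite in_cons la orbT.
by move=> c; rewrite in_cons => /predU1P[-> //|/a_min].
Qed.

Section Weights.
Variables (K : fieldType) (s : nat) (F : realDomainType) (w : 'I_s -> F).
Hypothesis w_ge0 : forall i, 0 <= w i.
Implicit Types (a b : 'X_{1..s}) (f g : {mpoly K[s]}).

Definition weight a : F := \sum_i (a i)%:R * w i.

Lemma weightD a b : weight (a + b) = weight a + weight b.
Proof.
by rewrite -big_split; apply: eq_bigr => i _; rewrite mnmDE natrD mulrDl.
Qed.

Lemma weight_ge0 a : 0 <= weight a.
Proof. by apply: sumr_ge0 => i _; rewrite mulr_ge0. Qed.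

Lemma weight0 : weight 0%MM = 0.
Proof. by apply: big1 => i _; rewrite mnm0E mul0r. Qed.

Lemma ideal_pow_weight (L : set {mpoly K[s]}) q n :
  L `<=` mon_supp (fun a => q <= weight a) ->
  ideal_pow L n `<=` mon_supp (fun a => n%:R * q <= weight a).
Proof.
move=> Lq.
apply: (ideal_pow_sub (J := fun n => mon_supp (fun a => n%:R * q <= weight a))).
- move=> k; apply: mon_supp_idealP => a b ka.
  by rewrite weightD; apply: le_trans ka _; rewrite lerDr weight_ge0.
- by rewrite -mpolyX0; apply/mon_suppX; rewrite mul0r weight0.
- move=> k f g /Lq; apply: mon_suppM => a b qa kb.
  by rewrite weightD -natr1 mulrDl mul1r addrC lerD.
Qed.

(** The least weight of a monomial of [f] is a valuation: the initial form
    [in f] of [f] has a nonzero [N]-th power, as polynomials form a domain,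
    and [f ^+ N - (in f) ^+ N] has weights above [N] times the least weight
    of [f].  In an equation of integral dependence of [f] over an ideal of
    weight at least [q], a least weight below [q] would make every term
    other than [f ^+ N] of larger weight, so [in f] would vanish. *)
Lemma integral_closure_weight (L : set {mpoly K[s]}) q :
  L `<=` mon_supp (fun a => q <= weight a) ->
  integral_closure L `<=` mon_supp (fun a => q <= weight a).
Proof.
move=> Lq f [N [c [N0 Lc fE]]] a0 fa0.
have [a fa a_min] := seq_argmin weight fa0.
suff : q <= weight a by move/le_trans; apply; apply: a_min.
rewrite leNgt; apply/negP => lt_aq.
set u := weight a in a_min lt_aq.
have f_ge : mon_supp (fun b => u <= weight b) f by [].
pose g := \sum_(b <- msupp f | weight b == u) f@_b *: 'X_[b].
pose h := \sum_(b <- msupp f | weight b != u) f@_b *: 'X_[b].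
have fgh : f = g + h by rewrite {1}(mpolyE f) (bigID (fun b => weight b == u)).
have g_eq : mon_supp (fun b => weight b = u) g.
  rewrite /g; elim/big_ind: _ => [|x y|b /eqP wb].
  - exact: mon_supp0.
  - exact: mon_suppD.
  - by move=> b' /msuppZ_le; rewrite msuppX inE => /eqP ->.
have h_gt : mon_supp (fun b => u < weight b) h.
  rewrite /h big_seq_cond; elim/big_ind: _ => [|x y|b /andP[fb wb]].
  - exact: mon_supp0.
  - exact: mon_suppD.
  - move=> b' /msuppZ_le; rewrite msuppX inE => /eqP ->.
    by rewrite lt_neqAle eq_sym wb a_min.
have expn n P Q f' : (forall n a b, Q n a -> P b -> Q n.+1 (a + b)%MM) ->
    Q 0%N 0%MM -> mon_supp P f' -> mon_supp (Q n) (f' ^+ n).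
  move=> PQ Q0 Pf'; elim: n => [|n IHn].
    by rewrite expr0 -mpolyX0; apply/mon_suppX.
  by rewrite exprSr; apply: mon_suppM IHn Pf' => x y; apply: PQ.
have f_exp n : mon_supp (fun b => n%:R * u <= weight b) (f ^+ n).
  apply: (expn n (fun b => u <= weight b) (fun n b => n%:R * u <= weight b)).
  - by move=> k x y kx uy; rewrite weightD -natr1 mulrDl mul1r lerD.
  - by rewrite mul0r weight0.
  - exact: f_ge.
have g_exp n : mon_supp (fun b => weight b = n%:R * u) (g ^+ n).
  apply: (expn n (fun b => weight b = u) (fun n b => weight b = n%:R * u)).
  - by move=> k x y kx uy; rewrite weightD -natr1 mulrDl mul1r kx uy.
  - by rewrite mul0r weight0.
  - exact: g_eq.
have fg_exp n : mon_supp (fun b => n%:R * u < weight b) (f ^+ n - g ^+ n).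
  elim: n => [|n IHn]; first by rewrite !expr0 subrr; apply: mon_supp0.
  have -> : f ^+ n.+1 - g ^+ n.+1 = (f ^+ n - g ^+ n) * f + g ^+ n * h.
    by rewrite [X in g ^+ n * X](_ : h = f - g) ?exprSr;
      [ring|rewrite fgh addrC addKr].
  apply: mon_suppD.
    apply: mon_suppM IHn f_ge => x y nx uy.
    by rewrite weightD -natr1 mulrDl mul1r ltr_leD.
  apply: mon_suppM (g_exp n) h_gt => x y nx uy.
  by rewrite weightD nx -natr1 mulrDl mul1r ler_ltD.
have fN_gt : mon_supp (fun b => N%:R * u < weight b) (f ^+ N).
  move/eqP: fE; rewrite addr_eq0 => /eqP ->; apply: mon_suppN.
  rewrite big_seq_cond; elim/big_ind: _ => [|x y|i].
  - exact: mon_supp0.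
  - exact: mon_suppD.
  rewrite andbT mem_index_iota => /andP[i0 iN].
  have ci := ideal_pow_weight Lq (Lc i (introT andP (conj i0 iN))).
  apply: mon_suppM ci (f_exp (N - i)%N) => x y ix Niy.
  rewrite weightD -{1}(subnKC (iN : (i <= N)%N)) natrD mulrDl ltr_leD //.
  by apply: lt_le_trans ix; rewrite ltr_pM2l // ltr0n.
have g_neq0 : g ^+ N != 0.
  rewrite expf_neq0 //; apply/eqP => g0.
  have : a \in msupp f by [].
  rewrite fgh g0 add0r => /h_gt; rewrite ltxx //.
have /negP[] := g_neq0; rewrite -msupp_eq0.
case E: (msupp (g ^+ N)) => [|b l] //.
have gb : b \in msupp (g ^+ N) by rewrite E mem_head.
have gN_gt : mon_supp (fun b => N%:R * u < weight b) (g ^+ N).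
  rewrite (_ : g ^+ N = f ^+ N - (f ^+ N - g ^+ N)); last by ring.
  by apply: mon_suppD => //; apply: mon_suppN.
by have := gN_gt _ gb; rewrite (g_exp _ _ gb) ltxx.
Qed.

End Weights.

(** * Polyhedra given by inequalities *)

Section Inequalities.
Variables (F : realFieldType) (s k : nat) (A : 'M[F]_(s, k)) (b : 'rV[F]_k).
Implicit Types (x u : 'rV[F]_s).

Definition feasible x : Prop := forall j, b 0 j <= (x *m A) 0 j.
Definition tight x : pred 'I_k := fun j => (x *m A) 0 j == b 0 j.

(** Walking from [x] in a direction parallel to the tight constraints, the
    first of the decreasing constraints to be exhausted becomes tight. *)
Lemma feasible_walk x u : feasible x ->
    (forall j, tight x j -> (u *m A) 0 j = 0) ->
    (exists j, (u *m A) 0 j < 0) ->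
  exists t, [/\ 0 < t, feasible (x + t *: u) &
    exists2 j, ~~ tight x j &
      tight (x + t *: u) j /\ {subset tight x <= tight (x + t *: u)}].
Proof.
move=> fx ux [j0 uj0].
pose ratio j := ((x *m A) 0 j - b 0 j) / - (u *m A) 0 j.
have [j uj jmin] : exists2 j, (u *m A) 0 j < 0 &
    forall i, (u *m A) 0 i < 0 -> ratio j <= ratio i.
  by case: (arg_minP (P := fun j => (u *m A) 0 j < 0) ratio uj0) => j uj jmin;
    exists j.
have ntj : ~~ tight x j by apply/negP => /ux uj_eq0; rewrite uj_eq0 ltxx in uj.
have walkE t i : ((x + t *: u) *m A) 0 i = (x *m A) 0 i + t * (u *m A) 0 i.
  by rewrite mulmxDl -scalemxAl !mxE.
have t_gt0 : 0 < ratio j.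
  by rewrite divr_gt0 ?oppr_gt0 // subr_gt0 lt_neqAle eq_sym ntj fx.
exists (ratio j); split=> //.
  move=> i; rewrite walkE; have [ui|ui] := ltP ((u *m A) 0 i) 0; last first.
    by apply: le_trans (fx i) _; rewrite lerDl mulr_ge0 // ltW.
  have := jmin i ui; rewrite /ratio -/(ratio j) ler_pdivlMr ?oppr_gt0 //.
  by rewrite mulrN; lra.
exists j => //; split.
  rewrite /tight walkE; apply/eqP; rewrite /ratio; field.
  by rewrite lt_eqF.
move=> i ti; rewrite unfold_in /tight walkE (ux i ti) mulr0 addr0; exact: ti.
Qed.

Definition tight_mx (T : pred 'I_k) : 'M[F]_(s, k) :=
  \matrix_(i, j) if T j then A i j else 0.
Definition tight_row (T : pred 'I_k) : 'rV[F]_k :=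
  \row_j if T j then b 0 j else 0.

Lemma mul_tight_mx (T : pred 'I_k) x j :
  (x *m tight_mx T) 0 j = if T j then (x *m A) 0 j else 0.
Proof.
rewrite !mxE; case Tj: (T j).
  by apply: eq_bigr => i _; rewrite mxE Tj.
by apply: big1 => i _; rewrite mxE Tj mulr0.
Qed.

Lemma mul_tight_mx_tight x : x *m tight_mx (tight x) = tight_row (tight x).
Proof.
by apply/rowP=> j; rewrite mul_tight_mx [RHS]mxE; case: ifP => // /eqP.
Qed.

End Inequalities.

Section RationalPolyhedra.
Variables (R : realType) (s k : nat) (A : 'M[rat]_(s, k)) (b : 'rV[rat]_k).

Local Notation AR := (map_mx (@ratr R) A).
Local Notation bR := (map_mx (@ratr R) b).
Local Notation P := ([set x | feasible AR bR x]).

Lemma feasible_map (y : 'rV[rat]_s) :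
  feasible AR bR (map_mx ratr y) <-> feasible A b y.
Proof.
by split=> fy j; have := fy j; rewrite -map_mxM !mxE /= ler_rat.
Qed.

Lemma map_tight_mx T : tight_mx AR T = map_mx ratr (tight_mx A T).
Proof. by apply/matrixP=> i j; rewrite !mxE; case: ifP; rewrite ?rmorph0. Qed.

Lemma map_tight_row T : tight_row bR T = map_mx ratr (tight_row b T).
Proof. by apply/rowP=> j; rewrite !mxE; case: ifP; rewrite ?rmorph0. Qed.

Lemma not_row_free_dir (F : fieldType) m n (M : 'M[F]_(m, n)) :
  ~~ row_free M -> exists2 u : 'rV_m, u != 0 & u *m M = 0.
Proof.
by rewrite -kermx_eq0 => /rowV0Pn[u /sub_kermxP uM u0]; exists u.
Qed.

(** At a vertex the tight constraints have full rank: otherwise one could walk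
    both ways along a line parallel to all of them, and a linear form cannot
    increase strictly in both directions.  Hence a vertex is the solution of a
    rational linear system. *)
Lemma vertex_rational (x : 'rV[R]_s) : is_vertex P x ->
  exists2 y, x = map_mx ratr y & feasible A b y.
Proof.
move=> [c [d [cd xE]]].
have [/= fx cx] : (P `&` [set y | dotp c y = d]) x by rewrite -xE.
pose T := tight AR bR x.
have [Tfree|/not_row_free_dir[u u0 uT]] := boolP (row_free (tight_mx A T)).
  have xy : x = map_mx ratr (tight_row b T *m pinvmx (tight_mx A T)).
    rewrite map_mxM -map_tight_row -mul_tight_mx_tight -/T map_tight_mx.
    by rewrite -mulmxA -map_mxM mulmxVp // map_mx1 mulmx1.
  by exists (tight_row b T *m pinvmx (tight_mx A T)); rewrite // -feasible_map -xy.
pose v := map_mx (@ratr R) u.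
have v0 : v != 0 by rewrite map_mx_eq0.
have vT j : tight AR bR x j -> (v *m AR) 0 j = 0.
  move=> Tj; rewrite -map_mxM mxE.
  by have /rowP/(_ j) := uT; rewrite mul_tight_mx -/T /T Tj [RHS]mxE => ->;
    rewrite rmorph0.
have dotD t w : dotp c (x + t *: w) = d + t * dotp c w.
  rewrite -cx /dotp mulr_sumr -big_split; apply: eq_bigr => i _ /=.
  by rewrite !mxE; ring.
have grow w : w != 0 -> (forall j, tight AR bR x j -> (w *m AR) 0 j = 0) ->
    0 < dotp c w.
  move=> w0 wT.
  have [t [t0 ft]] : exists t : R, 0 < t /\ feasible AR bR (x + t *: w).
    have [/existsP neg|/existsPn pos] := boolP [exists j, (w *m AR) 0 j < 0].
      by have [t [t0 ft _]] := feasible_walk fx wT neg; exists t.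
    exists 1; split=> // j; rewrite scale1r mulmxDl [leRHS]mxE.
    by apply: le_trans (fx j) _; rewrite lerDl leNgt.
  have := cd _ ft; rewrite dotD lerDl pmulr_rge0 // le_eqVlt => /predU1P[w_eq0|//].
  have : (P `&` [set y | dotp c y = d]) (x + t *: w).
    by split=> //=; rewrite dotD -w_eq0 mulr0 addr0.
  rewrite -xE /= => /eqP; rewrite -subr_eq0 addrC addKr scaler_eq0.
  by rewrite gt_eqF //= (negPf w0).
have := grow v v0 vT; have : 0 < dotp c (- v).
  by apply: grow => [|j Tj]; rewrite ?oppr_eq0 // mulNmx mxE vT ?oppr0.
rewrite [dotp c (- v)](_ : _ = - dotp c v) ?oppr_gt0 => [v_lt0 /(lt_trans v_lt0)|].
  by rewrite ltxx.
by rewrite /dotp -sumrN; apply: eq_bigr => i _; rewrite mxE mulrN.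
Qed.

(** The sum of the tight constraints exposes the point. *)
Lemma tight_vertex (y : 'rV[rat]_s) : feasible A b y ->
  row_free (tight_mx A (tight A b y)) -> is_vertex P (map_mx ratr y).
Proof.
set T := tight A b y => fy Tfree.
pose c : 'rV[R]_s := \row_i \sum_j tight_mx AR T i j.
have dotE z : dotp c z = \sum_j (z *m tight_mx AR T) 0 j.
  under [RHS]eq_bigr do rewrite mxE.
  rewrite exchange_big; apply: eq_bigr => i _ /=.
  by rewrite mxE mulr_suml; apply: eq_bigr => j _; rewrite mulrC.
exists c, (\sum_j tight_row bR T 0 j).
have le_tight z j : P z -> tight_row bR T 0 j <= (z *m tight_mx AR T) 0 j.
  by move=> fz; rewrite mul_tight_mx [X in X <= _]mxE; case: ifP.
have yT : map_mx ratr y *m tight_mx AR T = tight_row bR T.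
  by rewrite map_tight_mx map_tight_row -map_mxM mul_tight_mx_tight.
split=> [z fz|]; first by rewrite dotE; apply: ler_sum => j _; apply: le_tight.
apply/seteqP; split=> [_ ->|z [fz /= zE]].
  by split; [apply/feasible_map|rewrite /= dotE yT].
have zT : z *m tight_mx AR T = tight_row bR T.
  apply/rowP=> j; apply/eqP; rewrite -subr_eq0; apply/eqP.
  pose e i := (z *m tight_mx AR T) 0 i - tight_row bR T 0 i.
  have e_ge0 i : true -> 0 <= e i by rewrite subr_ge0 => _; apply: le_tight.
  apply: (psumr_eq0P e_ge0) => //.
  by rewrite sumrB -zE dotE subrr.
apply: (@row_free_inj _ _ _ _ (tight_mx AR T)); last by rewrite zT yT.
by rewrite map_tight_mx /row_free mxrank_map.
Qed.

End RationalPolyhedra.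

(** * Lattice points of covering polyhedra *)

Section Covering.
Variables (R : realType) (s m : nat) (C : 'M[rat]_(s, m)).
Hypothesis hC : covering_matrix C.
Implicit Types (a p : 'X_{1..s}) (y : 'rV[rat]_s) (l : seq 'X_{1..s}).

Local Notation Q := (covering_polyhedron R C).

(** The identity block makes every coordinate one of the constrained forms, so
    that any direction with a negative coordinate leads to the boundary. *)
Definition cov_mx : 'M[rat]_(s, s + m) := row_mx 1%:M C.
Definition cov_row : 'rV[rat]_(s + m) := row_mx 0 (const_mx 1).

Lemma covering_feasible (x : 'rV[R]_s) :
  Q x <-> feasible (map_mx ratr cov_mx) (map_mx ratr cov_row) x.
Proof.
rewrite /feasible /cov_mx /cov_row !map_row_mx map_mx1 mul_mx_row mulmx1; split.
  move=> [x0 x1] j; case: (split_ordP j) => i ->.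
    by rewrite !row_mxEl !mxE rmorph0.
  by rewrite !row_mxEr [leLHS]mxE [X in ratr X]mxE rmorph1.
move=> fx; split=> j.
  by have := fx (lshift m j); rewrite !row_mxEl !mxE rmorph0.
by have := fx (rshift s j); rewrite !row_mxEr [leLHS]mxE [X in ratr X]mxE rmorph1.
Qed.

Lemma covering_polyhedronE : Q =
  [set x | feasible (map_mx ratr cov_mx) (map_mx ratr cov_row) x].
Proof. by apply/seteqP; split=> x /covering_feasible. Qed.

Lemma feasible_covP y : feasible cov_mx cov_row y <->
  (forall i, 0 <= y 0 i) /\ (forall j, 1 <= (y *m C) 0 j).
Proof.
rewrite /feasible /cov_mx /cov_row mul_mx_row mulmx1; split.
  move=> fy; split=> j; first by have := fy (lshift m j); rewrite !row_mxEl mxE.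
  by have := fy (rshift s j); rewrite !row_mxEr [leLHS]mxE.
move=> [y0 y1] j; case: (split_ordP j) => i ->.
  by rewrite !row_mxEl mxE.
by rewrite !row_mxEr [leLHS]mxE.
Qed.

(** The exponents [a] with [a / n] in the polyhedron, for positive [n], described
    by rational inequalities without division. *)
Definition level n a : Prop := forall j, n%:R <= weight (fun i => C i j) a.

Lemma cov_ge0 j i : 0 <= C i j.
Proof. by case: hC. Qed.

Lemma levelD m1 m2 a b : level m1 a -> level m2 b -> level (m1 + m2) (a + b).
Proof. by move=> La Lb j; rewrite weightD natrD lerD. Qed.

Lemma level_up n a b : level n a -> level n (b + a).
Proof.
move=> La j; rewrite weightD; apply: le_trans (La j) _.
by rewrite lerDr; apply: weight_ge0; apply: cov_ge0.
Qed.

Definition mnm_frac (F : realFieldType) n a : 'rV[F]_s :=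
  \row_i ((a i)%:R / n%:R).

Lemma level_feasible n a : (0 < n)%N ->
  level n a <-> feasible cov_mx cov_row (mnm_frac rat n a).
Proof.
move=> n0; have n0' : 0 < n%:R :> rat by rewrite ltr0n.
have E j : (mnm_frac rat n a *m C) 0 j = weight (fun i => C i j) a / n%:R.
  rewrite mxE mulr_suml; apply: eq_bigr => i _.
  by rewrite mxE mulrAC.
rewrite feasible_covP; split=> [La|[_ a1] j]; last first.
  by have := a1 j; rewrite E ler_pdivlMr // mul1r.
split=> [i|j]; first by rewrite mxE divr_ge0.
by rewrite E ler_pdivlMr // mul1r.
Qed.

Lemma mnm_fracE n a : mnm_frac R n a = map_mx ratr (mnm_frac rat n a).
Proof. by apply/rowP=> i; rewrite !mxE fmorph_div /= !ratr_nat. Qed.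

Lemma level_covering n a : (0 < n)%N -> level n a <-> Q (mnm_frac R n a).
Proof.
move=> n0; rewrite (level_feasible _ n0) covering_feasible mnm_fracE.
by rewrite feasible_map.
Qed.

Lemma mnm_frac1 a (F : realFieldType) i : mnm_frac F 1 a 0 i = (a i)%:R.
Proof. by rewrite mxE divr1. Qed.

Lemma filtrationE (K : fieldType) n :
  (0 < n)%N -> filtration K R C n = mon_supp (K := K) (level n).
Proof.
case: n => // n _; rewrite -ideal_gen_mon; last exact: level_up.
rewrite /filtration; congr ideal_gen; apply/seteqP; split=> _ [a Qa ->].
  by exists a => //; apply/level_covering.
by exists a => //; apply/level_covering.
Qed.

(** * Averages of lattice points *)

Definition above_average y : Prop := exists l, [/\ (0 < size l)%N,
  forall p, p \in l -> level 1 p &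
  forall i, ((\sum_(p <- l) p)%MM i)%:R <= (size l)%:R * y 0 i].

Lemma above_average_le y (z : 'rV[rat]_s) : (forall i, y 0 i <= z 0 i) ->
  above_average y -> above_average z.
Proof.
move=> yz [l [l0 l1 ly]]; exists l; split=> // i.
by apply: le_trans (ly i) _; rewrite ler_wpM2l.
Qed.

(** Rational weights are realised by repetition, balanced by the lengths of
    the two families. *)
Lemma above_average_convex y (z x : 'rV[rat]_s) (p q : nat) : (0 < p + q)%N ->
    (p + q)%:R *: x = p%:R *: y + q%:R *: z ->
  above_average y -> above_average z -> above_average x.
Proof.
move=> pq0 xE [l [l0 l1 ly]] [l' [l0' l1' ly']].
pose rep k (r : seq 'X_{1..s}) := flatten (nseq k r).
have size_rep k r : size (rep k r) = (k * size r)%N.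
  by elim: k => //= k IHk; rewrite size_cat IHk mulSn.
have mem_rep k r t : t \in rep k r -> t \in r.
  by elim: k => //= k IHk; rewrite mem_cat => /orP[|/IHk].
have sum_rep k r i : ((\sum_(t <- rep k r) t)%MM i = k * (\sum_(t <- r) t)%MM i)%N.
  elim: k => [|k IHk]; first by rewrite big_nil mnm0E.
  by rewrite /= big_cat mnmDE IHk mulSn.
exists (rep (p * size l')%N l ++ rep (q * size l)%N l').
have sizeE : (size (rep (p * size l')%N l ++ rep (q * size l)%N l') =
    (p + q) * (size l * size l'))%N.
  by rewrite size_cat !size_rep; ring.
split=> [|t|i]; first by rewrite sizeE !muln_gt0 pq0 l0 l0'.
  by rewrite mem_cat => /orP[/mem_rep/l1|/mem_rep/l1'].
rewrite sizeE big_cat mnmDE !sum_rep natrM mulrAC.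
have /rowP/(_ i) := xE; rewrite !mxE => ->.
rewrite mulrDl natrD; apply: lerD; rewrite !natrM.
  have := ler_wpM2l (ler0n _ (p * size l')%N) (ly i).
  by rewrite natrM => /le_trans; apply; rewrite le_eqVlt; apply/predU1P; left; ring.
have := ler_wpM2l (ler0n _ (q * size l)%N) (ly' i).
by rewrite natrM => /le_trans; apply; rewrite le_eqVlt; apply/predU1P; left; ring.
Qed.

Lemma pos_ratP (t : rat) : 0 < t -> exists n d : nat,
  [/\ (0 < n)%N, (0 < d)%N & t = n%:R / d%:R].
Proof.
move=> t0; exists `|numq t|%N, `|denq t|%N.
rewrite !absz_gt0 denq_eq0 numq_eq0 gt_eqF //; split=> //.
by rewrite !natr_absz !gtr0_norm ?numq_gt0 ?denq_gt0 // divq_num_den.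
Qed.

(** The decomposition of a polyhedron into convex combinations of vertices plus
    a recession cone, by induction on the number of constraints that are not
    tight at [y].  Walking both ways along a direction parallel to the tight
    constraints exhibits [y] as a convex combination of points with more tight
    constraints; if the direction has coordinates of one sign only, [y] dominates
    the endpoint of the decreasing way. *)
Lemma integral_above_average y : integral_polyhedron Q ->
  feasible cov_mx cov_row y -> above_average y.
Proof.
move=> Qint; move: {2}#|_|.+1 (ltnSn #|predC (tight cov_mx cov_row y)|) => N.
elim: N y => // N IHN y; rewrite ltnS => yN fy.
have [Tfree|] := boolP (row_free (tight_mx cov_mx (tight cov_mx cov_row y))).
  have := tight_vertex R fy Tfree; rewrite -covering_polyhedronE => /Qint y_int.
  have /feasible_covP[y0 _] := fy.
  have yE i : exists n : nat, y 0 i = n%:R.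
    have := y_int i; rewrite mxE => /intrP[z zE].
    have /eqP : y 0 i = z%:~R.
      by apply: (fmorph_inj (@ratr R)); rewrite /= zE ratr_int.
    have := y0 i; case: z {zE} => n y_ge0 /eqP yz; first by exists n.
    by move: y_ge0; rewrite yz NegzE mulrNz oppr_ge0 lern0.
  have /fin_all_exists[p pE] := yE.
  pose a := [multinom p i | i < s].
  have ya : y = mnm_frac rat 1 a.
    by apply/rowP=> i; rewrite mnm_frac1 mnmE pE.
  exists [:: a]; split=> // [q|i].
    by rewrite inE => /eqP ->; apply/(level_feasible _ (isT : (0 < 1)%N)); rewrite -ya.
  by rewrite big_seq1 mul1r ya mnm_frac1.
move=> /not_row_free_dir[u u0 uT].
have dirT (v : 'rV[rat]_s) : v *m tight_mx cov_mx (tight cov_mx cov_row y) = 0 ->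
    forall j, tight cov_mx cov_row y j -> (v *m cov_mx) 0 j = 0.
  by move=> vT j Tj; have /rowP/(_ j) := vT; rewrite mul_tight_mx Tj [RHS]mxE.
have walk (v : 'rV[rat]_s) : v *m tight_mx cov_mx (tight cov_mx cov_row y) = 0 ->
    (exists i, v 0 i < 0) -> exists2 t, 0 < t & above_average (y + t *: v).
  move=> vT [i vi].
  have [|t [t0 ft [j ntj [tj sub]]]] := feasible_walk fy (dirT v vT).
    by exists (lshift m i); rewrite mul_mx_row mulmx1 row_mxEl.
  exists t => //; apply: IHN => //; apply: leq_trans yN.
  apply: proper_card; apply/properP; split.
    by apply/fintype.subsetP=> k; rewrite !inE; apply: contra => /sub.
  by exists j; rewrite !inE ?ntj // negbK.
have key (v : 'rV[rat]_s) : v *m tight_mx cov_mx (tight cov_mx cov_row y) = 0 ->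
    (exists i, v 0 i < 0) -> above_average y.
  move=> vT vneg; have [t t0 yt] := walk v vT vneg.
  have [/existsP[i vi]|/existsPn vpos] := boolP [exists i, 0 < v 0 i]; last first.
    apply: above_average_le yt => i; rewrite !mxE gerDl.
    by rewrite pmulr_rle0 // leNgt.
  have [||t' t0' yt'] := walk (- v); first by rewrite mulNmx vT oppr0.
    by exists i; rewrite mxE oppr_lt0.
  have [n [d [n0 d0 tE]]] := pos_ratP t0.
  have [n' [d' [n0' d0' tE']]] := pos_ratP t0'.
  apply: (above_average_convex (p := n' * d) (q := n * d')) yt yt'.
    by rewrite addn_gt0 muln_gt0 n0' d0.
  apply/rowP=> k; rewrite !mxE tE tE' natrD !natrM; field.
  by rewrite !pnatr_eq0 -!lt0n d0 d0'.
have [i ui] : exists i, u 0 i != 0.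
  apply/existsP; apply: contraNT u0 => /existsPn u0; apply/eqP/rowP=> i.
  by have := u0 i; rewrite negbK mxE => /eqP.
have [ui_lt0|ui_ge0] := ltP (u 0 i) 0; first by apply: (key u) => //; exists i.
apply: (key (- u)); first by rewrite mulNmx uT oppr0.
by exists i; rewrite mxE oppr_lt0 lt_neqAle eq_sym ui.
Qed.

(** * Powers of the first ideal *)

(** Exponents of monomials in the [n]-th power of the first ideal. *)
Definition lattice_sum n a : Prop := exists l, [/\ size l = n,
  forall p, p \in l -> level 1 p & (\sum_(p <- l) p <= a)%MM].

Lemma lepm_add a b a' b' : (a <= a' -> b <= b' -> a + b <= a' + b')%MM.
Proof.
by move=> /mnm_lepP la /mnm_lepP lb; apply/mnm_lepP => i; rewrite !mnmDE leq_add.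
Qed.

Lemma lattice_sum_up n a b : lattice_sum n a -> lattice_sum n (b + a).
Proof.
case=> l [ln l1 la]; exists l; split=> //.
by apply: lepm_trans la _; rewrite lem_addl.
Qed.

Lemma lattice_sum0 : lattice_sum 0 0%MM.
Proof. by exists [::]; rewrite big_nil; split=> //; apply: lepm_refl. Qed.

Lemma lattice_sumD n1 n2 a b :
  lattice_sum n1 a -> lattice_sum n2 b -> lattice_sum (n1 + n2) (a + b).
Proof.
move=> [l [ln l1 la]] [l' [ln' l1' lb]]; exists (l ++ l').
split=> [|p|]; first by rewrite size_cat ln ln'.
  by rewrite mem_cat => /orP[/l1|/l1'].
by rewrite big_cat lepm_add.
Qed.

Lemma lattice_sum1 a : level 1 a -> lattice_sum 1 a.
Proof.
move=> a1; exists [:: a]; split=> // [p|]; first by rewrite inE => /eqP ->.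
by rewrite big_seq1; apply: lepm_refl.
Qed.

Section Powers.
Variable K : fieldType.
Local Notation I1 := (filtration K R C 1).

Lemma ideal_pow_lattice (L : set {mpoly K[s]}) k n :
    L `<=` mon_supp (lattice_sum k) ->
  ideal_pow L n `<=` mon_supp (lattice_sum (n * k)).
Proof.
move=> Lk; apply: (ideal_pow_sub (J := fun n => mon_supp (lattice_sum (n * k)))).
- by move=> i; apply: mon_supp_idealP => a b; apply: lattice_sum_up.
- by rewrite -mpolyX0; apply/mon_suppX/lattice_sum0.
- by move=> i f g /Lk; apply: mon_suppM => a b; rewrite mulSn; apply: lattice_sumD.
Qed.

Lemma ideal_pow_lattice_sum n :
  ideal_pow I1 n `<=` mon_supp (lattice_sum n).
Proof.
rewrite -{2}(muln1 n); apply: ideal_pow_lattice => f.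
by rewrite filtrationE // => f1 a /f1/lattice_sum1.
Qed.

Lemma ideal_pow_filtration n :
  (0 < n)%N -> ideal_pow I1 n `<=` filtration K R C n.
Proof.
move=> n0 f /ideal_pow_lattice_sum fn; rewrite filtrationE // => a /fn.
move=> [l [<- l1 la]]; rewrite -(submK la); apply: level_up.
elim: l l1 {la n0 fn} => [|p l IHl] l1; first by move=> j; rewrite big_nil weight0.
rewrite big_cons; apply: (@levelD 1); first exact/l1/mem_head.
by apply: IHl => q lq; apply: l1; rewrite inE lq orbT.
Qed.

Lemma integral_closure_filtration (L : set {mpoly K[s]}) n : (0 < n)%N ->
  L `<=` filtration K R C n -> integral_closure L `<=` filtration K R C n.
Proof.
move=> n0; rewrite !filtrationE // => Ln f fL a fa j.
have := integral_closure_weight (cov_ge0 j) _ fL fa; apply.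
by move=> g /Ln gn b /gn.
Qed.

(** If [a / n] dominates the average of [N] lattice points [p], then the [N]-th
    power of [X^a] is a multiple of the product of the [X^p], each taken [n]
    times, so it lies in the [N]-th power of [I_1 ^ n].  General elements of
    [I_n] follow because integral closures are ideals. *)
Lemma filtration_sub_closure n : integral_polyhedron Q -> (0 < n)%N ->
  filtration K R C n `<=` integral_closure (ideal_pow I1 n).
Proof.
move=> Qint n0; rewrite filtrationE // -ideal_gen_mon; last exact: level_up.
apply: ideal_gen_min; first exact: integral_closure_ideal.
move=> _ [a an ->].
have /integral_above_average : feasible cov_mx cov_row (mnm_frac rat n a).
  exact/level_feasible.
case=> // l [l0 l1 la]; apply: (mem_integral_closure_pow l0).
have le_la : (\sum_(p <- l) p *+ n <= a *+ size l)%MM.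
  apply/mnm_lepP=> i; rewrite mnm_sumE mulmnE.
  under eq_bigr do rewrite mulmnE.
  rewrite -big_distrl -mnm_sumE -(ler_nat rat) !natrM.
  have := ler_wpM2r (ler0n _ n) (la i).
  by rewrite mxE -mulrA divfK ?pnatr_eq0 -?lt0n // [_ * (a i)%:R]mulrC.
rewrite mpolyXn -(submK le_la) mpolyXD.
case: (ideal_powP (ideal_pow I1 n) (size l)) => _ _; apply.
have -> : 'X_[\sum_(p <- l) p *+ n] = \prod_(p <- l) 'X_[K, p] ^+ n.
  rewrite (big_morph _ (@mpolyXD s K) (@mpolyX0 s K)).
  by apply: eq_bigr => p _; rewrite mpolyXn.
apply: ideal_pow_prod => p lp; apply: ideal_powX.
by rewrite filtrationE //; apply/mon_suppX/l1.
Qed.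

(** In an equation of integral dependence of degree [N] for [X^a], the
    coefficient of [X^(N a)] must cancel against some [c_i X^((N - i) a)], so
    [X^(i a)] occurs in [c_i], which lies in the [i]-th power of a monomial
    ideal. *)
Lemma closure_monomial n a : integral_closure (ideal_pow I1 n) 'X_[a] ->
  exists2 i, (0 < i)%N & lattice_sum (i * n) (a *+ i).
Proof.
move=> [N [c [N0 Ic E]]].
have pow_sum i : ideal_pow (ideal_pow I1 n) i `<=` mon_supp (lattice_sum (i * n)).
  exact/ideal_pow_lattice/ideal_pow_lattice_sum.
have [/hasP[i]|/hasPn cN0] :=
  boolP (has (fun i => (c i)@_(a *+ i) != 0) (index_iota 1 N.+1)).
  rewrite mem_index_iota => /andP[i0 iN] ci; exists i => //.
  by apply: (pow_sum i _ (Ic i _)); rewrite ?mcoeff_msupp // i0.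
have /(congr1 (mcoeff (a *+ N)%MM)) := E.
rewrite mcoeff0 mcoeffD mpolyXn mcoeffX eqxx raddf_sum big_seq big1 => [/eqP|i ci].
  by rewrite addr0 oner_eq0.
have := cN0 _ ci; move: ci; rewrite mem_index_iota => /andP[i0 iN].
rewrite negbK => /eqP ci.
have -> : (a *+ N = a *+ (N - i) + a *+ i)%MM.
  by apply/mnmP => k; rewrite mnmDE !mulmnE -mulnDr subnK.
by rewrite /= mpolyXn mcoeffMX.
Qed.

(** A vertex of a covering polyhedron has a common denominator [n], and then
    [n] times the vertex is the exponent of a monomial in [I_n].  If some
    multiple of this exponent is above a sum of lattice points, then the
    linear form exposing the vertex has on one of these points a value no
    larger than at the vertex, and this point is the vertex. *)
Lemma closure_integral :
  (forall n, (0 < n)%N ->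
     filtration K R C n `<=` integral_closure (ideal_pow I1 n)) ->
  integral_polyhedron Q.
Proof.
move=> sub x vx.
have [y xy fy] : exists2 y, x = map_mx ratr y & feasible cov_mx cov_row y.
  by apply: (@vertex_rational R); rewrite -covering_polyhedronE.
have [y0 _] := (feasible_covP y).1 fy.
pose n := (\prod_i `|denq (y 0%R i)|)%N.
have n0 : (0 < n)%N by apply: prodn_gt0 => i; rewrite absz_gt0 denq_eq0.
have [a aE] : exists a, forall i, (a i)%:R = n%:R * y 0 i.
  exists [multinom `|numq (y 0%R i)| * \prod_(j | j != i) `|denq (y 0%R j)| | i < s]%N => i.
  rewrite mnmE /n [in RHS](bigD1 i) //= !natrM mulrAC; congr (_ * _).
  by rewrite !natr_absz ger0_norm ?numq_ge0 ?gtr0_norm ?denq_gt0 // numqE mulrC.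
have ya : y = mnm_frac rat n a.
  by apply/rowP=> i; rewrite mxE aE mulrAC divff ?mul1r // pnatr_eq0 -lt0n.
have [i i0 [l [li l1 la]]] : exists2 i, (0 < i)%N & lattice_sum (i * n) (a *+ i).
  apply: closure_monomial; apply: sub => //; rewrite filtrationE //.
  by apply/mon_suppX/level_feasible; rewrite // -ya.
move: vx => [c [d [cd xE]]].
have [/= Qx cx] : (Q `&` [set z | dotp c z = d]) x by rewrite -xE.
(* [c] is bounded below on [Q], which is stable under increasing coordinates. *)
have c0 j : 0 <= c 0 j.
  have Qxj : Q (x + delta_mx 0 j).
    move: Qx => [x0 x1]; split=> k.
      by rewrite mxE addr_ge0 // mxE; case: (_ && _).
    rewrite mulmxDl mxE; apply: le_trans (x1 k) _; rewrite lerDl mxE.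
    apply: sumr_ge0 => h _; rewrite mulr_ge0 // mxE ?ler0q; last exact: cov_ge0.
    by case: (_ && _).
  have := cd _ Qxj; rewrite -cx /dotp -subr_ge0 -sumrB (bigD1 j) //= big1.
    by rewrite addr0 !mxE !eqxx mulrDr mulr1 addrC addKr.
  by move=> h hj; rewrite !mxE (negPf hj) andbF addr0 subrr.
have [p lp cp] : exists2 p, p \in l & dotp c (mnm_frac R 1 p) <= d.
  apply/hasP; apply: contraT => /hasPn gt_d.
  have xa k : (a k)%:R = n%:R * x 0 k.
    by rewrite xy mxE -(ratr_nat R (a k)) aE rmorphM /= ratr_nat.
  have : \sum_(p <- l) dotp c (mnm_frac R 1 p) <= (i * n)%:R * d.
    rewrite /dotp exchange_big -cx /dotp mulr_sumr; apply: ler_sum => k _ /=.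
    rewrite -mulr_sumr mulrCA ler_wpM2l // natrM -mulrA -xa -natrM mulnC -mulmnE.
    under eq_bigr do rewrite mnm_frac1.
    by rewrite -natr_sum -mnm_sumE ler_nat; move/mnm_lepP: la.
  rewrite leNgt => /negP[].
  have : (0 < size l)%N by rewrite li muln_gt0 i0.
  rewrite -li mulr_natl; case: (l) gt_d => //= q l' gt_d _.
  rewrite big_cons mulrS ltr_leD ?ltNge ?gt_d ?mem_head //.
  elim: l' gt_d => [|q' l' IHl] gt_d; first by rewrite big_nil.
  rewrite big_cons mulrS; apply: lerD.
    by rewrite ltW // ltNge gt_d // !inE eqxx orbT.
  apply: IHl => r rl; apply: gt_d; move: rl.
  by rewrite !inE => /orP[->|->]; rewrite ?orbT.
have : (Q `&` [set z | dotp c z = d]) (mnm_frac R 1 p).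
  have Qp : Q (mnm_frac R 1 p) by apply/level_covering => //; apply: l1.
  by split=> //=; apply/eqP; rewrite eq_le cp cd.
by rewrite -xE /= => <- k; rewrite mnm_frac1.
Qed.

End Powers.
End Covering.

(** * Integral polyhedra and normal ideals *)

Theorem proposition3p9 (K : fieldType) (R : realType) (s m : nat)
    (C : 'M[rat]_(s, m)) (hC : covering_matrix C) :
  ((forall n, (1 <= n)%N ->
      integral_closure (ideal_pow (filtration K R C 1) n) = filtration K R C n)
   <-> integral_polyhedron (covering_polyhedron R C))
  /\
  ((forall n, (1 <= n)%N ->
      ideal_pow (filtration K R C 1) n = filtration K R C n)
   <-> (integral_polyhedron (covering_polyhedron R C) /\
        normal_ideal (filtration K R C 1))).
Proof.
have closureE : (forall n, (1 <= n)%N ->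
    integral_closure (ideal_pow (filtration K R C 1) n) = filtration K R C n)
   <-> integral_polyhedron (covering_polyhedron R C).
  split=> [E|Qint n n0].
    by apply: (closure_integral hC (K := K)) => n n0; rewrite E.
  apply/seteqP; split; last exact: filtration_sub_closure.
  by apply: integral_closure_filtration => //; apply: ideal_pow_filtration.
split=> //; split=> [E|[/closureE E normI] n n0]; last by rewrite normI // E.
have closed n : (1 <= n)%N ->
    integral_closure (filtration K R C n) = filtration K R C n.
  move=> n0; apply/seteqP; split; last exact: sub_integral_closure.
  exact: integral_closure_filtration.
split=> [|n n0]; last by rewrite E // closed.
by apply/closureE => n n0; rewrite E // closed.
Qed.
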